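(* Let $0<\lambda<1$. The nonsingular HK$(+1,\lambda)$ transformation $(X,S_\lambda,\mathcal B,\mu)$ is ergodic and of type $\mathrm{III}_\lambda$.
   Context: The nonsingular HK$(+1,\lambda)$ transformation $(X,S_\lambda,\mathcal B,\mu)$ is constructed by cutting and stacking. A column is a finite ordered collection $C_k=\{C_k(0),\dots,C_k(h_k-1)\}$ of pairwise disjoint intervals (levels); $h_k$ is its height. Start with $C_0=\{[0,1)\}$, $h_0=1$. Given $C_k$, cut each level $C_k(i)$ into a left subinterval $C_k(i)^{\mathrm{left}}$ and a right subinterval $C_k(i)^{\mathrm{right}}$ whose lengths satisfy $|C_k(i)^{\mathrm{right}}|=\lambda\,|C_k(i)^{\mathrm{left}}|$. Stack the right subcolumn on top of the left subcolumn, and put $2h_k+1$ new disjoint intervals (spacers) of positive finite length on top; that is, $C_{k+1}(i)=C_k(i)^{\mathrm{left}}$ for $0\le i<h_k$, $C_{k+1}(i)=C_k(i-h_k)^{\mathrm{right}}$ for $h_k\le i<2h_k$, and $C_{k+1}(i)$ is a new spacer interval for $2h_k\le i<4h_k+1$; so $h_{k+1}=4h_k+1$. The maximum length of the levels of $C_k$ tends to $0$ as $k\to\infty$. The space $X$ is the union of all levels of all columns, $\mathcal B$ its Borel sets, $\mu$ is Lebesgue measure, and $S_\lambda$ is the a.e. defined map sending each level $C_k(i)$, $0\le i<h_k-1$, to $C_k(i+1)$ by the orientation-preserving affine bijection (these maps are consistent as $k$ grows). A transformation $T$ is nonsingular if it is measurable and $\mu(A)=0$ if and only if $\mu(T^{-1}A)=0$.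 It is ergodic if $\mu(T^{-1}A\triangle A)=0$ implies $\mu(A)=0$ or $\mu(A^c)=0$. Ratio set: for an invertible ergodic nonsingular transformation $T$ of a $\sigma$-finite space $(X,\mu)$, let $\omega_n=\frac{d\mu\circ T^n}{d\mu}$ and $$r(T)=\{t\in[0,\infty):\ \forall \epsilon>0\ \forall A \text{ with } \mu(A)>0,\ \exists n>0,\ \mu(A\cap T^{-n}A\cap\{x:|\omega_n(x)-t|<\epsilon\})>0\}.$$ For $\lambda\in(0,1)$, $T$ is of type $\mathrm{III}_\lambda$ if $r(T)=\{\lambda^n:n\in\mathbb Z\}\cup\{0\}$. *)

(* Defs.v *)
From HB Require Import structures.
From mathcomp Require Import all_boot all_order all_algebra.
From mathcomp Require Import all_classical all_reals all_analysis.
Import Order.TTheory GRing.Theory Num.Theory.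
Import numFieldNormedType.Exports.

Set Implicit Arguments.
Unset Strict Implicit.
Unset Printing Implicit Defensive.

Local Open Scope classical_set_scope.
Local Open Scope ring_scope.

(* The measure space is a set X inside an ambient measurable type, with the
   measurable subsets of X and the measure mu; the values of a transformation
   of X outside X are irrelevant. *)
Section NonsingularTransformations.
Context {d : measure_display} {U : measurableType d} {R : realType}.
Variables (X : set U) (mu : {sigma_finite_measure set U -> \bar R}).
Variable T : U -> U.

Definition nonsingular : Prop :=
  [/\ set_fun X X T, measurable_fun X T &
      forall A, measurable A -> A `<=` X ->
        mu A = 0%E <-> mu (X `&` T @^-1` A) = 0%E].

Definition ergodic : Prop :=
  forall A, measurable A -> A `<=` X ->
    mu ((X `&` T @^-1` A) `+` A) = 0%E ->
    mu A = 0%E \/ mu (X `\` A) = 0%E.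

(* Invertible up to null sets: the inverse is defined on T(X), which has full
   measure, and is measurable. *)
Definition invertible_ae : Prop :=
  [/\ set_inj X T,
      forall A, measurable A -> A `<=` X -> measurable (T @` A) &
      mu (X `\` T @` X) = 0%E].

Definition is_RN_derivative (nu : set U -> \bar R) (w : U -> R) : Prop :=
  [/\ measurable_fun X w, forall x, X x -> 0 <= w x &
      forall A, measurable A -> A `<=` X ->
        (\int[mu]_(x in A) (w x)%:E)%E = nu A].

(* A version of d(mu o T^n)/d(mu).  The library's Radon_Nikodym only covers
   finite charges, and mu o T^n need not be finite. *)
Definition omega (n : nat) : U -> R :=
  xget (cst 0) [set w | is_RN_derivative (fun A => mu (iter n T @` A)) w].

Definition ratio_set : set R :=
  [set t | 0 <= t /\
    forall e : R, 0 < e -> forall A, measurable A -> A `<=` X -> (0 < mu A)%E ->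
      exists n, (0 < n)%N /\
        (0 < mu (A `&` iter n T @^-1` A
                   `&` [set x | (`|omega n x - t| < e)%R]))%E].

(* The ratio set is only meaningful for invertible ergodic nonsingular T, so
   these requirements are part of the definition of the type. *)
Definition type_III (lambda : R) : Prop :=
  [/\ nonsingular, invertible_ae, ergodic &
      ratio_set = [set lambda ^ n | n in [set: int]] `|` [set 0]].

End NonsingularTransformations.

(* An interval [a, b[ is encoded by the pair (a, b).  Columns are sequences of
   intervals, from bottom to top; spacers k are the intervals put on top of the
   (k+1)-st column. *)
Section HKTransformation.
Context {R : realType}.
Variables (lambda : R) (spacers : nat -> seq (R * R)).

Definition level_set (c : R * R) : set R := `[c.1, c.2[%classic.

(* Splits c so that the right part is lambda times as long as the left one. *)
Definition cut (c : R * R) : R := c.1 + (c.2 - c.1) / (1 + lambda).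

Definition cut_left (c : R * R) : R * R := (c.1, cut c).

Definition cut_right (c : R * R) : R * R := (cut c, c.2).

Fixpoint HK_column (k : nat) : seq (R * R) :=
  if k is k'.+1 then
    map cut_left (HK_column k') ++ map cut_right (HK_column k') ++ spacers k'
  else [:: (0, 1)].

Definition HK_height (k : nat) : nat := size (HK_column k).

Definition HK_level (k i : nat) : R * R := nth (0, 0) (HK_column k) i.

(* The requirements on the choice of the spacers. Disjointness of the levels of
   every column says that new spacers are disjoint from each other and from all
   earlier levels. *)
Definition HK_spacers : Prop :=
  [/\ forall k, size (spacers k) = (2 * HK_height k + 1)%N,
      forall k c, c \in spacers k -> c.1 < c.2,
      forall k, trivIset `I_(HK_height k) (fun i => level_set (HK_level k i)) &
      (fun k => \big[Num.max/0]_(c <- HK_column k) (c.2 - c.1))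
        @ \oo --> (0 : R)].

Definition HK_space : set (measurableTypeR R) :=
  \bigcup_k \bigcup_(i in `I_(HK_height k)) level_set (HK_level k i).

Definition affine_bij (c c' : R * R) (x : R) : R :=
  c'.1 + (c'.2 - c'.1) / (c.2 - c.1) * (x - c.1).

(* The common value of the affine maps of a level onto the next one at x; these
   maps agree as k grows, and each point of HK_space lies below the top of some
   column. *)
Definition HK_map (x : measurableTypeR R) : measurableTypeR R :=
  xget x [set y | exists k i, [/\ (i.+1 < HK_height k)%N,
    level_set (HK_level k i) x &
    y = affine_bij (HK_level k i) (HK_level k i.+1) x]].

End HKTransformation.

(* Main.v *)
Require Import Defs.
From mathcomp Require Import all_boot all_order all_algebra.
From mathcomp Require Import all_classical all_reals all_analysis.
From mathcomp Require Import measurable_realfun.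
From mathcomp Require Import ring lra zify.
Import Order.TTheory GRing.Theory Num.Theory.
Import numFieldNormedType.Exports.

(* On each level of a column, HK_map iterates are affine onto higher levels, so
   d(mu o T^n)/dmu is there the ratio of the two lengths. By Lebesgue density a
   set of positive measure almost fills some level of every late column. An
   invariant set has the same density in all levels of a column, which gives
   ergodicity. For the ratio set, cut a level I filled by A up to a small error
   p + 1 more times: the sublevel with itinerary u followed by L is carried,
   with ratio lambda^(1 + #R(v) - #R(u)), onto the later sublevel with itinerary
   v followed by R, and both are mostly in A; every power of lambda arises in
   this way, and 0 is a limit of such powers. Conversely all sublevels of [0, 1[
   in one column have lengths lambda^a times a common constant, so returns to
   [0, 1[ only see powers of lambda, however long the spacers are. *)

Set Implicit Arguments.
Unset Strict Implicit.
Unset Printing Implicit Defensive.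

Local Open Scope classical_set_scope.
Local Open Scope ring_scope.

(** * Affine bijections between intervals and their effect on Lebesgue measure *)

Section AffineMaps.
Context {R : realType}.
Implicit Types (c : R * R) (A : set (measurableTypeR R)).
Local Notation mu := (@lebesgue_measure R).

Definition len c := c.2 - c.1.

Lemma level_setE c x : level_set c x <-> c.1 <= x < c.2.
Proof. by rewrite /level_set /= in_itv. Qed.

Lemma measurable_level_set c :
  measurable (level_set c : set (measurableTypeR R)).
Proof. exact: measurable_itv. Qed.

Lemma level_set_measure c : 0 < len c -> mu (level_set c) = (len c)%:E.
Proof.
by rewrite subr_gt0 => lc; rewrite lebesgue_measure_itv/= lte_fin lc EFinB.
Qed.

Lemma affine_bijE c c' x :
  affine_bij c c' x = (c'.1 - len c' / len c * c.1) + len c' / len c * x.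
Proof. by rewrite /affine_bij -!/(len _); ring. Qed.

Lemma affine_bij_level c c' x : 0 < len c -> 0 < len c' -> level_set c x ->
  level_set c' (affine_bij c c' x).
Proof.
move=> lc lc' /level_setE/andP[cx xc]; apply/level_setE.
rewrite /affine_bij -!/(len _); apply/andP; split.
  by rewrite lerDl mulr_ge0 ?subr_ge0// divr_ge0// ltW.
by rewrite -ltrBrDl mulrAC ltr_pdivrMr// ltr_pM2l// ltrD2r.
Qed.

Lemma affine_bij_comp c c' c'' x : len c' != 0 ->
  affine_bij c' c'' (affine_bij c c' x) = affine_bij c c'' x.
Proof.
move=> lc'; rewrite /affine_bij -!/(len _).
by rewrite [_ - c'.1]addrC addKr mulrA mulrA divfK.
Qed.

Lemma affine_bij_id c x : 0 < len c -> affine_bij c c x = x.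
Proof.
by move=> lc; rewrite /affine_bij -!/(len _) divff ?gt_eqF// mul1r subrKC.
Qed.

Lemma affine_bij_inj c c' x y : 0 < len c -> 0 < len c' ->
  affine_bij c c' x = affine_bij c c' y -> x = y.
Proof.
move=> lc lc' /(congr1 (affine_bij c' c)).
by rewrite !affine_bij_comp ?gt_eqF// !affine_bij_id.
Qed.

Lemma ltr_affine_bij c c' x y : 0 < len c -> 0 < len c' ->
  (affine_bij c c' x < affine_bij c c' y) = (x < y).
Proof.
by move=> lc lc'; rewrite /affine_bij ltrD2l ltr_pM2l ?divr_gt0// ltrD2r.
Qed.

Lemma ler_affine_bij c c' x y : 0 < len c -> 0 < len c' ->
  (affine_bij c c' x <= affine_bij c c' y) = (x <= y).
Proof.
by move=> lc lc'; rewrite /affine_bij lerD2l ler_pM2l ?divr_gt0// lerD2r.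
Qed.

Lemma measurable_affine_bij c c' :
  measurable_fun [set: measurableTypeR R]
    (affine_bij c c' : measurableTypeR R -> measurableTypeR R).
Proof.
apply: measurable_funD => //; apply: measurable_funM => //.
exact: measurable_funB.
Qed.

Lemma measurable_affine_bij_preimage c c' A : measurable A ->
  measurable (affine_bij c c' @^-1` A : set (measurableTypeR R)).
Proof.
by move=> mA; rewrite -[X in measurable X]setTI; exact: measurable_affine_bij.
Qed.

(** The pushforward of [mu], rescaled by the slope, agrees with [mu] on the intervals []a, b]], so
    uniqueness of Lebesgue measure identifies the two. *)
Lemma lebesgue_measure_affine_bij c c' A : 0 < len c -> 0 < len c' ->
  measurable A ->
  mu (affine_bij c c' @^-1` A) = ((len c / len c')%:E * mu A)%E.
Proof.
move=> lc lc' mA; have r0 : 0 <= len c' / len c by rewrite divr_ge0// ltW.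
pose f : measurableTypeR R -> measurableTypeR R := affine_bij c c'.
have mf : measurable_fun setT f by exact: measurable_affine_bij.
pose nu := mscale (NngNum r0) (pushforward mu f).
have -> : mu A = nu mf A.
  apply: lebesgue_measure_unique => //= _ [[a b]] _ <-.
  rewrite /nu /= /mscale/= /pushforward.
  rewrite (_ : f @^-1` _ = `]affine_bij c' c a, affine_bij c' c b]%classic).
    rewrite !lebesgue_measure_itv/= !lte_fin ltr_affine_bij//.
    case: ifP => _; last by rewrite mule0.
    rewrite -!EFinB -EFinM; congr EFin.
    rewrite !affine_bijE; field; lra.
  have gK y : affine_bij c c' (affine_bij c' c y) = y.
    by rewrite affine_bij_comp ?gt_eqF// affine_bij_id.
  apply/seteqP; split=> x /=; rewrite !in_itv/= /f.
    by rewrite -{1}(gK a) -{1}(gK b) ltr_affine_bij// ler_affine_bij.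
  by rewrite -{2}(gK a) -{2}(gK b) ltr_affine_bij// ler_affine_bij.
rewrite /nu/= /mscale/= muleA -EFinM mulrA divfK ?gt_eqF// divff ?gt_eqF//.
by rewrite mul1e.
Qed.

Lemma lebesgue_measure_affine_bij_level c c' A : 0 < len c -> 0 < len c' ->
  measurable A ->
  mu (level_set c `&` affine_bij c c' @^-1` A) =
  ((len c / len c')%:E * mu (level_set c' `&` A))%E.
Proof.
move=> lc lc' mA; rewrite -lebesgue_measure_affine_bij//; last first.
  by apply: measurableI => //; exact: measurable_level_set.
congr (mu _); rewrite preimage_setI; congr (_ `&` _).
apply/seteqP; split=> x /=; first exact: affine_bij_level.
move=> /(affine_bij_level lc' lc).
by rewrite affine_bij_comp ?gt_eqF// affine_bij_id.
Qed.

End AffineMaps.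

(** * Combinatorics of the columns and pointwise behaviour of the map *)

Section HKColumns.
Context {R : realType} {lambda : R} {spacers : nat -> seq (R * R)}.
Hypotheses (lambda_gt0 : 0 < lambda) (sp : HK_spacers lambda spacers).
Local Notation h := (HK_height lambda spacers).
Local Notation lv := (HK_level lambda spacers).
Local Notation L k i := (level_set (HK_level lambda spacers k i)).
Local Notation X := (HK_space lambda spacers).
Local Notation T := (HK_map lambda spacers).
Implicit Types (c : R * R) (i j k n : nat).

Let lambda1_gt0 : 0 < 1 + lambda. Proof. by rewrite addr_gt0. Qed.

Lemma len_cut_left c : len (cut_left lambda c) = len c / (1 + lambda).
Proof. by rewrite /cut_left /len /= /Defs.cut addrC addKr. Qed.

Lemma len_cut_right c :
  len (cut_right lambda c) = len c * lambda / (1 + lambda).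
Proof.
by rewrite /cut_right /len /= /Defs.cut; field; rewrite lt0r_neq0.
Qed.

Lemma level_set_cut c x : 0 < len c ->
  level_set c x <->
  level_set (cut_left lambda c) x \/ level_set (cut_right lambda c) x.
Proof.
move=> lc; have /andP[cl cr] : c.1 < Defs.cut lambda c < c.2.
  rewrite -[_ < Defs.cut _ _]subr_gt0 -[_ < c.2]subr_gt0.
  have := len_cut_left c; have := len_cut_right c.
  rewrite /cut_left /cut_right /len/= => -> ->.
  by rewrite !(divr_gt0, mulr_gt0).
rewrite !level_setE /=; split=> [|[]] /andP[x1 x2].
- by case: (ltP x (Defs.cut lambda c)) => xc; [left|right]; rewrite ?x1 ?x2 ?xc.
- by rewrite x1 (lt_trans x2).
- by rewrite x2 (le_trans _ x1)// ltW.
Qed.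

(** Both levels are cut in the same proportion, so the affine map between the left parts restricts
    the one between the whole levels. With the analogue for right parts, this makes the maps of
    successive columns consistent. *)
Lemma affine_bij_cut_left c c' x : 0 < len c ->
  affine_bij (cut_left lambda c) (cut_left lambda c') x = affine_bij c c' x.
Proof.
move=> lc; rewrite /affine_bij -!/(len _) !len_cut_left/=; field.
by rewrite !lt0r_neq0.
Qed.

Lemma affine_bij_cut_right c c' x : 0 < len c ->
  affine_bij (cut_right lambda c) (cut_right lambda c') x = affine_bij c c' x.
Proof.
move=> lc; rewrite /affine_bij -!/(len _) !len_cut_right/= /Defs.cut -!/(len _).
by field; rewrite !lt0r_neq0.
Qed.

Lemma HK_heightS k : h k.+1 = (4 * h k + 1)%N.
Proof.
case: sp => /(_ k) + _ _ _; rewrite /HK_height/= !size_cat !size_map => ->; lia.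
Qed.

Lemma HK_height_gt k : (k < h k)%N.
Proof. by elim: k => // k IH; rewrite HK_heightS; lia. Qed.

Lemma HK_level_left k i : (i < h k)%N -> lv k.+1 i = cut_left lambda (lv k i).
Proof.
by move=> ik; rewrite /HK_level/= nth_cat size_map ik (nth_map (0, 0)).
Qed.

Lemma HK_level_right k i : (i < h k)%N ->
  lv k.+1 (h k + i) = cut_right lambda (lv k i).
Proof.
move=> ik; rewrite /HK_level/= nth_cat size_map -/(h k) ltnNge leq_addr/=.
by rewrite addKn nth_cat size_map ik (nth_map (0, 0)).
Qed.

Lemma len_HK_level_gt0 k i : (i < h k)%N -> 0 < len (lv k i).
Proof.
elim: k i => [[]// _|k IH i ik]; first by rewrite /len/= subr0.
have [ihk|hki] := ltnP i (h k).
  by rewrite HK_level_left// len_cut_left divr_gt0// IH.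
have [ihk|hhki] := ltnP (i - h k) (h k).
  rewrite -(subnKC hki) HK_level_right// len_cut_right.
  by rewrite divr_gt0// mulr_gt0// IH.
rewrite /HK_level /= nth_cat size_map -/(h k) ltnNge hki/=.
rewrite nth_cat size_map -/(h k) ltnNge hhki/= subr_gt0.
case: sp => ssz s0 _ _; apply: (s0 k); apply: mem_nth; rewrite ssz.
by move: ik; rewrite HK_heightS; lia.
Qed.
Hint Resolve len_HK_level_gt0 : core.

Lemma HK_level_uniq k i j x : (i < h k)%N -> (j < h k)%N -> L k i x ->
  L k j x -> i = j.
Proof.
by case: sp => _ _ /(_ k) tL _ ik jk ix jx; apply: tL => //; exists x.
Qed.

(** The shift [d] is [0] or [h k], according to the part of the level containing [x]. It does not
    depend on [j], so the whole column moves up together and the affine maps between its levels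
    persist. *)
Lemma HK_level_refineS k i x : (i < h k)%N -> L k i x ->
  exists d, [/\ (d <= h k)%N, L k.+1 (d + i) x &
    forall j y, (j < h k)%N ->
    affine_bij (lv k.+1 (d + i)) (lv k.+1 (d + j)) y =
    affine_bij (lv k i) (lv k j) y].
Proof.
move=> ik /(level_set_cut _ (len_HK_level_gt0 ik))[] ix.
  exists 0%N; split=> [//||j y jk]; rewrite !add0n ?HK_level_left//.
  by rewrite affine_bij_cut_left//; exact: len_HK_level_gt0.
exists (h k); split=> [//||j y jk]; rewrite ?HK_level_right//.
by rewrite affine_bij_cut_right//; exact: len_HK_level_gt0.
Qed.

Lemma HK_level_refine k k' i x : (k < k')%N -> (i < h k)%N -> L k i x ->
  exists d, [/\ (d + h k < h k')%N, L k' (d + i) x &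
    forall j y, (j < h k)%N ->
    affine_bij (lv k' (d + i)) (lv k' (d + j)) y =
    affine_bij (lv k i) (lv k j) y].
Proof.
move=> + ik ix; elim: k' => // k' IH.
rewrite ltnS leq_eqVlt => /predU1P[<-|kk'].
  have [d [dk dix dE]] := HK_level_refineS ik ix.
  by exists d; split=> //; rewrite HK_heightS; lia.
have [d [dk dix dE]] := IH kk'.
have dik : (d + i < h k')%N by lia.
have [d' [dk' dix' dE']] := HK_level_refineS dik dix.
exists (d' + d)%N; split; first by rewrite HK_heightS; lia.
  by rewrite -addnA.
by move=> j y jk; rewrite -!addnA dE' ?dE//; lia.
Qed.

(** One more step puts over [2 * h k] spacers above both copies of column [k], and [h k > k], so in
    late columns a point has any prescribed number of levels above it. *)
Lemma HK_spaceP x : X x -> exists K, forall n k, (K < k)%N -> (n < k)%N ->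
  exists i, (i + n < h k)%N /\ L k i x.
Proof.
move=> [K _ [i /= iK ix]]; exists K => n [//|k]; rewrite ltnS => Kk nk.
have [j [jk jx]] : exists j, (j < h k)%N /\ L k j x.
  move: Kk; rewrite leq_eqVlt => /predU1P[<-|Kk]; first by exists i.
  have [d [dk dix dE]] := HK_level_refine Kk iK ix.
  by exists (d + i)%N; split=> //; lia.
have [d [dk dix _]] := HK_level_refineS jk jx.
exists (d + j)%N; split=> //; rewrite HK_heightS.
by have := HK_height_gt k; lia.
Qed.

Lemma HK_level_space k i : (i < h k)%N -> L k i `<=` X.
Proof. by move=> ik x ix; exists k => //; exists i. Qed.

(** The value chosen by [xget] may come from another column [k']. Both affine maps persist in a
    column beyond [k] and [k'], where disjointness puts [x] in a single level, so they agree at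
    [x]. *)
Lemma HK_mapE k i x : (i.+1 < h k)%N -> L k i x ->
  T x = affine_bij (lv k i) (lv k i.+1) x.
Proof.
move=> ik ix; rewrite /HK_map.
case: xgetP => [y _ [k' [i' [ik' ix' ->]]]|]; last first.
  by move=> /(_ (affine_bij (lv k i) (lv k i.+1) x)) []; exists k, i.
pose K := (maxn k k').+1.
have kK : (k < K)%N by rewrite ltnS leq_maxl.
have kK' : (k' < K)%N by rewrite ltnS leq_maxr.
have [d [dk dix dE]] := HK_level_refine kK (ltnW ik) ix.
have [d' [dk' dix' dE']] := HK_level_refine kK' (ltnW ik') ix'.
rewrite -dE// -dE'// !addnS; have -> // : (d + i = d' + i')%N.
by apply: (HK_level_uniq _ _ dix dix'); lia.
Qed.

Lemma HK_map_iterE n k i x : (i + n < h k)%N -> L k i x ->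
  iter n T x = affine_bij (lv k i) (lv k (i + n)) x.
Proof.
elim: n => [|n IH] ik ix.
  by rewrite addn0 affine_bij_id// len_HK_level_gt0//; lia.
rewrite iterS IH//; last lia.
rewrite (@HK_mapE k (i + n)); [|lia|].
  by rewrite addnS affine_bij_comp// gt_eqF// len_HK_level_gt0//; lia.
by apply: affine_bij_level ix; apply: len_HK_level_gt0; lia.
Qed.

Lemma HK_map_iter_level n k i x : (i + n < h k)%N -> L k i x ->
  L k (i + n) (iter n T x).
Proof.
move=> ik ix; rewrite (HK_map_iterE ik ix).
by apply: affine_bij_level ix; apply: len_HK_level_gt0; lia.
Qed.

Lemma HK_map_space : set_fun X X T.
Proof.
move=> x /HK_spaceP[K /(_ 1%N K.+2)[//|//|i [ik ix]]].
exact: HK_level_space ik _ (HK_map_iter_level ik ix).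
Qed.

Lemma HK_map_iter_space n : set_fun X X (iter n T).
Proof. by elim: n => [//|n IH] x /IH/HK_map_space. Qed.

Lemma HK_map_inj : set_inj X T.
Proof.
move=> x y /[!inE] /HK_spaceP[K Kx] /HK_spaceP[K' Ky] Txy.
have [||i [ik ix]] := Kx 1%N (maxn K K').+2; [lia..|].
have [||j [jk jy]] := Ky 1%N (maxn K K').+2; [lia..|].
(* The common image lies in levels [i + 1] and [j + 1] of one column, so [i = j] and the same
   injective affine map acts on both points. *)
have := HK_map_iter_level jk jy; rewrite /= -Txy.
move=> /(HK_level_uniq ik jk (HK_map_iter_level ik ix)) /eqP.
rewrite eqn_add2r => /eqP ij; subst j; move: Txy.
rewrite addn1 in ik; rewrite (HK_mapE ik ix) (HK_mapE ik jy).
by apply: affine_bij_inj; apply: len_HK_level_gt0; lia.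
Qed.

Lemma HK_map_iter_inj n : set_inj X (iter n T).
Proof.
elim: n => [//|n IH] x y /[!inE] Xx Xy /=.
by move=> /HK_map_inj /[!inE] /(_ (HK_map_iter_space _ Xx)
  (HK_map_iter_space _ Xy)) /IH; rewrite !inE; exact.
Qed.

(* The top levels are excluded, so T^n is affine on each piece. *)
Lemma HK_space_partition n : exists F : (set (measurableTypeR R))^nat,
  [/\ X = \bigcup_m F m, trivIset setT F, forall m, measurable (F m) &
    forall m, exists k i, (i + n < h k)%N /\ F m `<=` L k i].
Proof.
pose G m : set (measurableTypeR R) := if unpickle m is Some (k, i) then
  if (i + n < h k)%N then L k i else set0 else set0.
have mG m : measurable (G m).
  rewrite /G; case: unpickle => [[k i]|//]; case: ifP => // _.
  exact: measurable_level_set.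
exists (seqDU G); split.
- rewrite -seqDU_bigcup_eq; apply/seteqP; split=> [x Xx|x [m _]].
    have [K /(_ n (maxn K n).+1)[||i [ik ix]]] := HK_spaceP Xx; [lia..|].
    by exists (pickle ((maxn K n).+1, i)) => //; rewrite /G pickleK ik.
  rewrite /G; case: unpickle => [[k i]|//]; case: ifP => // ik.
  by apply: HK_level_space; lia.
- exact: trivIset_seqDU.
- by move=> m; apply: measurableD => //; exact: bigsetU_measurable.
- move=> m.
  suff [k [i [ik Gm]]] : exists k i, (i + n < h k)%N /\ G m `<=` L k i.
    by exists k, i; split=> //; apply: subset_trans Gm; exact: subset_seqDU.
  have nn : (0 + n < h n)%N := HK_height_gt n.
  rewrite /G; case: unpickle => [[k i]|]; last by exists n, 0%N; split.
  by case: ifP => ik; [exists k, i; split|exists n, 0%N; split].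
Qed.

Lemma measurable_HK_space : measurable (X : set (measurableTypeR R)).
Proof.
have [F [-> _ mF _]] := HK_space_partition 0; exact: bigcup_measurable.
Qed.

End HKColumns.

(** * Measurability, null sets and Radon-Nikodym derivatives of the iterates *)

Section HKMeasure.
Context {R : realType} {lambda : R} {spacers : nat -> seq (R * R)}.
Hypotheses (lambda_gt0 : 0 < lambda) (sp : HK_spacers lambda spacers).
Local Notation h := (HK_height lambda spacers).
Local Notation lv := (HK_level lambda spacers).
Local Notation L k i := (level_set (HK_level lambda spacers k i)).
Local Notation X := (HK_space lambda spacers).
Local Notation T := (HK_map lambda spacers).
Local Notation mu := (@lebesgue_measure R).
Implicit Types (A : set (measurableTypeR R)) (i j k n : nat).

Let len_gt0 := len_HK_level_gt0 lambda_gt0 sp.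

(** Writing the image as a preimage under the inverse affine map reduces its measurability and
    measure to those of preimages. *)
Lemma HK_map_iter_image n k i A : (i + n < h k)%N -> A `<=` L k i ->
  iter n T @` A =
  L k (i + n) `&` affine_bij (lv k (i + n)) (lv k i) @^-1` A.
Proof.
move=> ik Ai; have i0 : 0 < len (lv k i) by apply: len_gt0; lia.
have in0 : 0 < len (lv k (i + n)) by exact: len_gt0.
apply/seteqP; split=> [_ [x Ax <-]|y [iny Ay]].
  split; first exact: HK_map_iter_level ik (Ai _ Ax).
  rewrite /= (HK_map_iterE lambda_gt0 sp ik (Ai _ Ax)).
  by rewrite affine_bij_comp ?gt_eqF// affine_bij_id.
exists (affine_bij (lv k (i + n)) (lv k i) y) => //.
rewrite (HK_map_iterE lambda_gt0 sp ik (Ai _ Ay)).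
by rewrite affine_bij_comp ?gt_eqF// affine_bij_id.
Qed.

Lemma measurable_HK_map_iter_image_level n k i A : (i + n < h k)%N ->
  measurable A -> A `<=` L k i -> measurable (iter n T @` A).
Proof.
move=> ik mA Ai; rewrite (HK_map_iter_image ik)//; apply: measurableI.
  exact: measurable_level_set.
exact: measurable_affine_bij_preimage.
Qed.

Lemma HK_map_iter_image_measure n k i A : (i + n < h k)%N ->
  measurable A -> A `<=` L k i ->
  mu (iter n T @` A) =
  ((len (lv k (i + n)) / len (lv k i))%:E * mu A)%E.
Proof.
move=> ik mA Ai; have i0 : 0 < len (lv k i) by apply: len_gt0; lia.
rewrite (HK_map_iter_image ik)//.
rewrite lebesgue_measure_affine_bij_level//; last exact: len_gt0.
by rewrite (setIidr Ai).
Qed.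

Lemma HK_map_iter_preimage n k i A : (i + n < h k)%N ->
  L k i `&` iter n T @^-1` A =
  L k i `&` affine_bij (lv k i) (lv k (i + n)) @^-1` A.
Proof.
move=> ik; apply/seteqP; split=> x [ix]/=.
  by rewrite (HK_map_iterE lambda_gt0 sp ik ix).
by move=> Ax; split=> //=; rewrite (HK_map_iterE lambda_gt0 sp ik ix).
Qed.

Lemma measurable_HK_map_iter_preimage n k i A : (i + n < h k)%N ->
  measurable A -> measurable (L k i `&` iter n T @^-1` A).
Proof.
move=> ik mA; rewrite HK_map_iter_preimage//; apply: measurableI.
  exact: measurable_level_set.
exact: measurable_affine_bij_preimage.
Qed.

Lemma HK_map_iter_preimage_measure n k i A : (i + n < h k)%N ->
  measurable A ->
  mu (L k i `&` iter n T @^-1` A) =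
  ((len (lv k i) / len (lv k (i + n)))%:E * mu (L k (i + n) `&` A))%E.
Proof.
move=> ik mA; rewrite HK_map_iter_preimage//.
by rewrite lebesgue_measure_affine_bij_level//; apply: len_gt0; lia.
Qed.

Lemma measurable_fun_HK_map_iter n :
  measurable_fun X (iter n T : measurableTypeR R -> measurableTypeR R).
Proof.
have [F [-> tF mF FL]] := HK_space_partition lambda_gt0 sp n.
apply/measurable_fun_bigcup => // m _ A mA.
have [k [i [ik Fi]]] := FL m.
rewrite -(setIidl Fi) -setIA; apply: measurableI => //.
exact: measurable_HK_map_iter_preimage.
Qed.

Lemma measurable_HK_map_iter_image n A : measurable A -> A `<=` X ->
  measurable (iter n T @` A).
Proof.
move=> mA AX; have [F [XF tF mF FL]] := HK_space_partition lambda_gt0 sp n.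
rewrite -(setIidl AX) XF setI_bigcupr image_bigcup.
apply: bigcup_measurable => m _; have [k [i [ik Fi]]] := FL m.
apply: (measurable_HK_map_iter_image_level ik); first exact: measurableI.
by move=> x [_ /Fi].
Qed.

Lemma HK_space_scaling_partition n :
  exists (F : (set (measurableTypeR R))^nat) (r : nat -> R),
  [/\ X = \bigcup_m F m, trivIset setT F, forall m, measurable (F m) &
    forall m, 0 < r m /\
    forall A, measurable A -> A `<=` F m ->
      mu (iter n T @` A) = ((r m)%:E * mu A)%E].
Proof.
have [F [XF tF mF FL]] := HK_space_partition lambda_gt0 sp n.
suff /choice[r rP] : forall m, exists r : R, 0 < r /\
    forall A, measurable A -> A `<=` F m ->
      mu (iter n T @` A) = (r%:E * mu A)%E by exists F, r.
move=> m; have [k [i [ik Fi]]] := FL m.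
exists (len (lv k (i + n)) / len (lv k i)); split.
  by rewrite divr_gt0//; apply: len_gt0; lia.
move=> A mA AF; apply: HK_map_iter_image_measure => //.
exact: subset_trans AF Fi.
Qed.

Lemma HK_map_iter_image_series n (F : (set (measurableTypeR R))^nat) A :
  X = \bigcup_m F m -> trivIset setT F -> (forall m, measurable (F m)) ->
  measurable A -> A `<=` X ->
  mu (iter n T @` A) = (\sum_(m <oo) mu (iter n T @` (A `&` F m)))%E.
Proof.
move=> XF tF mF mA AX.
rewrite -[in LHS](setIidl AX) XF setI_bigcupr image_bigcup.
have AFX m : A `&` F m `<=` X by move=> x [/AX].
rewrite measure_semi_bigcup//.
- move=> m; apply: measurable_HK_map_iter_image => //; exact: measurableI.
(* Injectivity of [iter n T] on [X] keeps the images of the pieces disjoint. *)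
- move=> i j _ _ [y [[x [Ax Fx] <-] [z [Az Fz]]]].
  move=> /(HK_map_iter_inj lambda_gt0 sp) /[!inE] /(_ (AX _ Az) (AX _ Ax)) zx.
  by apply: tF => //; exists x; split=> //; rewrite -zx.
- apply: bigcup_measurable => m _; apply: measurable_HK_map_iter_image => //.
  exact: measurableI.
Qed.

Lemma HK_map_iter_image_measure0 n A : measurable A -> A `<=` X ->
  mu (iter n T @` A) = 0%E <-> mu A = 0%E.
Proof.
move=> mA AX; have [F [r [XF tF mF rP]]] := HK_space_scaling_partition n.
have mAF m : measurable (A `&` F m) by exact: measurableI.
have imE m : mu (iter n T @` (A `&` F m)) = ((r m)%:E * mu (A `&` F m))%E.
  by apply: (rP m).2.
split=> [TA0|A0].
  rewrite -(setIidl AX) XF setI_bigcupr measure_semi_bigcup//.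
  - apply: eseries0 => m _ _; have := imE m.
    rewrite (subset_measure0 _ _ _ TA0).
    + move=> /esym/eqP; rewrite mule_eq0 eqe gt_eqF ?(rP m).1//= => /eqP.
      exact.
    + by apply: measurable_HK_map_iter_image => //; move=> x [/AX].
    + exact: measurable_HK_map_iter_image.
    + by apply: image_subset => x [].
  - exact: trivIset_setIl.
  - exact: bigcup_measurable.
rewrite (HK_map_iter_image_series n XF tF mF mA AX); apply: eseries0 => m _ _.
by rewrite imE (subset_measure0 (B := A)) ?mule0.
Qed.

(** A piecewise constant function works: the scaling factor [r m] on the piece [F m], with the
    default [0] outside [X]. *)
Lemma ex_HK_RN_derivative n :
  exists w, is_RN_derivative X mu (fun A => mu (iter n T @` A)) w.
Proof.
have [F [r [XF tF mF rP]]] := HK_space_scaling_partition n.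
pose w (x : measurableTypeR R) := xget 0 [set s | exists m, F m x /\ s = r m].
have wE m x : F m x -> w x = r m.
  move=> Fx; rewrite /w; case: xgetP => [_ _ [m' [Fx' ->]]|]; last first.
    by move=> /(_ (r m))[]; exists m.
  by congr r; apply: tF => //; exists x.
have mw : measurable_fun X w.
  rewrite XF; apply/measurable_fun_bigcup => // m.
  apply: (@eq_measurable_fun _ _ _ _ _ (cst (r m))) => [x /[!inE] /wE -> //|].
  exact: measurable_cst.
have w0 x : X x -> 0 <= w x.
  by rewrite XF => -[m _ /wE ->]; rewrite ltW// (rP m).1.
exists w; split=> // A mA AX.
have mAF m : measurable (A `&` F m) by exact: measurableI.
rewrite (HK_map_iter_image_series n XF tF mF mA AX).
have AE : A = \bigcup_m (A `&` F m) by rewrite -setI_bigcupr -XF (setIidl AX).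
rewrite [in LHS]AE ge0_integral_bigcup//.
- apply: eq_eseriesr => m _; rewrite (rP m).2//.
  rewrite -integral_cst//; apply: eq_integral => x /[!inE] -[_ /wE ->//].
- rewrite -AE; apply/measurable_EFinP; apply: measurable_funS mw => //.
  exact: measurable_HK_space.
- by rewrite -AE => x /AX /w0; rewrite lee_fin.
- exact: trivIset_setIl.
Qed.

Lemma omega_HK_map_RN n :
  is_RN_derivative X mu (fun A => mu (iter n T @` A)) (omega X mu T n).
Proof.
rewrite /omega; case: xgetP => [w _ //|].
by have [w Xw] := ex_HK_RN_derivative n => /(_ w).
Qed.

(** [omega] is only some version of the derivative, hence the statement almost everywhere: on a
    level, which has finite measure, it has the same integrals over measurable subsets as the
    constant ratio. *)
Lemma omega_HK_map_ae n k i : (i + n < h k)%N ->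
  {ae mu, forall x, L k i x ->
    omega X mu T n x = len (lv k (i + n)) / len (lv k i)}.
Proof.
move=> ik; set r := _ / _.
have [mw w0 wE] := omega_HK_map_RN n.
have LX : L k i `<=` X by apply: HK_level_space; lia.
have mL : measurable (L k i : set (measurableTypeR R)).
  exact: measurable_level_set.
have muL : (mu (L k i) < +oo)%E.
  by rewrite level_set_measure ?ltry//; apply: len_gt0; lia.
have : ae_eq mu (L k i) (cst r%:E) (EFin \o omega X mu T n).
  apply: integral_ae_eq => //.
  - apply/integrableP; split; first exact: measurable_cst.
    by rewrite /= integral_cst// lte_mul_pinfty.
  - apply/measurable_EFinP; apply: measurable_funS mw => //.
    exact: measurable_HK_space.
  - move=> A AL mA; rewrite integral_cst//= wE//; last exact: subset_trans LX.
    by rewrite (HK_map_iter_image_measure ik mA AL).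
by apply: filterS => x /= xw /xw [->].
Qed.

End HKMeasure.

(** * Measure-theoretic tools: null sets and Lebesgue density *)

Lemma measure_setI_setY0 d (U : measurableType d) (R : realType)
    (m : {measure set U -> \bar R}) (A B C : set U) :
  measurable A -> measurable B -> measurable C -> m (A `+` B) = 0%E ->
  m (C `&` A) = m (C `&` B).
Proof.
move=> mA mB mC AB0; have mCA := measurableI _ _ mC mA.
have mCB := measurableI _ _ mC mB.
have mAB : measurable (A `+` B) by apply: measurableU; exact: measurableD.
rewrite (measureDI m mCA mB) (measureDI m mCB mA) (setIAC C B).
congr (_ + _)%E.
rewrite (subset_measure0 (measurableD mCA mB) mAB _ AB0); last first.
  by move=> x [[_ Ax] nBx]; left.
rewrite (subset_measure0 (measurableD mCB mA) mAB _ AB0)//.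
by move=> x [[_ Bx] nAx]; right.
Qed.

Lemma ae_exists d (U : measurableType d) (R : realType)
    (m : {measure set U -> \bar R}) (A : set U) (P : U -> Prop) :
  measurable A -> (0 < m A)%E -> {ae m, forall x, P x} ->
  exists x, A x /\ P x.
Proof.
move=> mA A0 [N [mN N0 PN]]; apply: contrapT => nAP; move: A0.
rewrite lt_neqAle eq_sym => /andP[/eqP + _]; apply.
apply: (subset_measure0 mA mN) N0 => x Ax; apply: PN => Px.
by apply: nAP; exists x.
Qed.

(** Take a density point [x] of [A]. Wherever [x] sits in a short interval [c], the ball of radius
    [2 * len c] around [x] contains [c] and has measure [4 * len c]; hence the threshold [e / 4] on
    balls. *)
Lemma lebesgue_density_level (R : realType) (A : set (measurableTypeR R))
    (e : R) :
  measurable A -> (0 < lebesgue_measure A)%E -> 0 < e ->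
  exists x (d : R), [/\ A x, 0 < d & forall c, 0 < len c -> len c < d ->
    level_set c x ->
    (lebesgue_measure (level_set c `\` A) < (e * len c)%:E)%E].
Proof.
move=> mA A0 e0; have mcA : measurable (~` A) by exact: measurableC.
have [x [Ax]] := ae_exists mA A0 (lebesgue_density mcA).
rewrite indicE memNset// => /= h.
have [d d0 dP] : \forall r \near (0 : R)^'+,
    (lebesgue_measure (~` A `&` ball x r) *
    (lebesgue_measure (ball x r))^-1 < (e / 4)%:E)%E.
  apply: (h [set y | y < (e / 4)%:E]%E); apply: open_ereal_lt'.
  by rewrite lte_fin divr_gt0.
exists x, (d / 2); split=> [//||c lc cd cx]; first by rewrite divr_gt0.
have l0 : 0 < 2 * len c by rewrite mulr_gt0.
have cA : level_set c `\` A `<=` ~` A `&` ball x (2 * len c).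
  move=> y [cy nAy]; split=> //; rewrite /ball/= ltr_norml.
  move: cx cy lc => /level_setE + /level_setE; rewrite /len; lra.
have := dP (2 * len c); rewrite /ball/= sub0r normrN gtr0_norm// => /(_ _ l0).
rewrite lebesgue_measure_ball ?ltW// inver mulrn_eq0/= gt_eqF//.
rewrite lte_pdivrMr ?mulrn_wgt0// => dlt.
apply: (le_lt_trans (y := lebesgue_measure (~` A `&` ball x (2 * len c)))).
  apply: le_measure => //; rewrite inE; last first.
    by apply: measurableI => //; exact: measurable_ball.
  by apply: measurableD => //; exact: measurable_level_set.
rewrite (_ : e * len c = e / 4 * (2 * len c *+ 2)).
  by apply: dlt; lra.
by field.
Qed.

(** * Nonsingularity, invertibility and ergodicity *)

Section HKErgodic.
Context {R : realType} {lambda : R} {spacers : nat -> seq (R * R)}.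
Hypotheses (lambda_gt0 : 0 < lambda) (sp : HK_spacers lambda spacers).
Local Notation h := (HK_height lambda spacers).
Local Notation lv := (HK_level lambda spacers).
Local Notation L k i := (level_set (HK_level lambda spacers k i)).
Local Notation X := (HK_space lambda spacers).
Local Notation T := (HK_map lambda spacers).
Local Notation mu := (@lebesgue_measure R).
Implicit Types (A : set (measurableTypeR R)) (i j k n : nat).

Let len_gt0 := len_HK_level_gt0 lambda_gt0 sp.
Let mX := measurable_HK_space lambda_gt0 sp.

Lemma HK_mesh (e : R) : 0 < e -> exists K, forall k i, (K < k)%N ->
  (i < h k)%N -> len (lv k i) < e.
Proof.
move=> e0; case: sp => _ _ _ /cvgrPdist_lt /(_ e e0) [K _ Ke].
exists K => k i Kk ik; apply: le_lt_trans (Ke k (ltnW Kk)).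
rewrite sub0r normrN; apply: le_trans (ler_norm _).
rewrite /len; apply: (@le_bigmax_seq _ _ _ _ _ (lv k i) xpredT
  (fun c : R * R => c.2 - c.1)) => //.
exact: mem_nth.
Qed.

(** A density point of [A] lies in some level of every late column, and those levels are eventually
    short enough. *)
Lemma HK_density A (e : R) : measurable A -> A `<=` X -> (0 < mu A)%E ->
  0 < e -> exists K, forall k, (K < k)%N ->
    exists i, (i < h k)%N /\ (mu (L k i `\` A) < (e * len (lv k i))%:E)%E.
Proof.
move=> mA AX A0 e0.
have [x [d [Ax d0 dP]]] := lebesgue_density_level mA A0 e0.
have [K Kx] := HK_spaceP lambda_gt0 sp (AX _ Ax).
have [K' Kd] := HK_mesh d0.
exists (maxn K K') => k Kk; have [||i [ik ix]] := Kx 0%N k; [lia..|].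
rewrite addn0 in ik; exists i; split=> //; apply: dP => //.
  exact: len_gt0.
by apply: Kd => //; lia.
Qed.

Lemma HK_level0_left k : (lv k 0).1 = 0.
Proof.
elim: k => // k IH; rewrite HK_level_left; first exact: IH.
exact: leq_ltn_trans (leq0n _) (HK_height_gt lambda_gt0 sp k).
Qed.

(** A point with a level below it in some column has a preimage there. A missed point therefore lies
    in the bottom level of every late column; these levels start at [0] and shrink. *)
Lemma HK_map_coimage : X `\` T @` X `<=` [set (0 : R)].
Proof.
move=> x [Xx nTx]; have [K Kx] := HK_spaceP lambda_gt0 sp Xx.
have x0 k : (K < k)%N -> L k 0 x.
  move=> Kk; have [||i [ik ix]] := Kx 0%N k; [lia..|].
  case: i ik ix => // i; rewrite addn0 => ik ix; case: nTx.
  exists (affine_bij (lv k i.+1) (lv k i) x).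
    apply: (HK_level_space (ltnW ik)).
    by apply: affine_bij_level ix; apply: len_gt0; lia.
  rewrite (HK_mapE lambda_gt0 sp ik).
    by rewrite affine_bij_comp ?affine_bij_id ?gt_eqF//; apply: len_gt0; lia.
  by apply: affine_bij_level ix; apply: len_gt0; lia.
have x_ge0 : 0 <= x.
  by have /level_setE/andP[] := x0 K.+1 (leqnn _); rewrite HK_level0_left.
apply/eqP; rewrite eq_le x_ge0 andbT; apply/ler_addgt0Pl => e e0.
rewrite addr0; have [K' Ke] := HK_mesh e0.
have hK : (0 < h (maxn K K').+1)%N.
  exact: leq_ltn_trans (leq0n _) (HK_height_gt lambda_gt0 sp _).
have /level_setE/andP[_] : L (maxn K K').+1 0 x by apply: x0; lia.
have : len (lv (maxn K K').+1 0) < e by apply: Ke => //; lia.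
rewrite /len HK_level0_left subr0 => /[swap] /lt_trans /[apply].
exact: ltW.
Qed.

Lemma measurable_HK_map_preimage A : measurable A ->
  measurable (X `&` T @^-1` A).
Proof.
by move=> mA; exact: (measurable_fun_HK_map_iter lambda_gt0 sp 1 mX).
Qed.

Lemma HK_nonsingular : nonsingular X mu T.
Proof.
split; first exact: HK_map_space.
  exact: (measurable_fun_HK_map_iter lambda_gt0 sp 1).
move=> A mA AX; have mTA := measurable_HK_map_preimage mA.
have TAX : X `&` T @^-1` A `<=` X by move=> x [].
rewrite -(HK_map_iter_image_measure0 lambda_gt0 sp 1 mTA TAX)/=.
have TTA : T @` (X `&` T @^-1` A) `<=` A by move=> _ [x [_ Ax] <-].
have mTTA : measurable (T @` (X `&` T @^-1` A)).
  exact: (measurable_HK_map_iter_image lambda_gt0 sp 1).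
split=> [A0|TA0]; first exact: subset_measure0 A0.
(* The image of the preimage recovers [A] except possibly at [0], so its nullity passes to [A]. *)
have A0T : A `<=` [set (0 : R)] `|` T @` (X `&` T @^-1` A).
  move=> x Ax; have [[y Xy yx]|nTx] := pselect ((T @` X) x).
    by right; exists y => //; split=> //=; rewrite yx.
  by left; apply: HK_map_coimage; split=> //; exact: AX.
apply/(negligibleP _ mA); apply: (negligibleS A0T).
apply: negligibleU; last exact/negligibleP.
by apply/negligibleP => //; exact: lebesgue_measure_set1.
Qed.

Lemma HK_invertible_ae : invertible_ae X mu T.
Proof.
split; first exact: HK_map_inj.
  by move=> A mA AX; exact: (measurable_HK_map_iter_image lambda_gt0 sp 1).
have mTX : measurable (T @` X).
  exact: (measurable_HK_map_iter_image lambda_gt0 sp 1).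
apply: (subset_measure0 _ _ HK_map_coimage (lebesgue_measure_set1 0)) => //.
exact: measurableD.
Qed.

(** Induction on [i]: on level [i], invariance replaces [A] by its preimage, whose trace is the
    affine copy of the trace of [A] on level [i.+1]. *)
Lemma HK_invariant_density A k i : measurable A -> A `<=` X ->
  mu ((X `&` T @^-1` A) `+` A) = 0%E -> (i < h k)%N ->
  mu (L k i `&` A) =
  ((len (lv k i) / len (lv k 0))%:E * mu (L k 0 `&` A))%E.
Proof.
move=> mA AX invA; have mTA := measurable_HK_map_preimage mA.
have meq B : measurable B -> B `<=` X ->
    mu (B `&` A) = mu (B `&` T @^-1` A).
  move=> mB BX; have <- := measure_setI_setY0 (m := mu) mTA mA mB invA.
  by rewrite setIA (setIidl BX).
elim: i => [|i IH] ik.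
  by rewrite divff ?mul1e// gt_eqF// len_gt0.
have li : 0 < len (lv k i) by apply: len_gt0; lia.
have li1 : 0 < len (lv k i.+1) by apply: len_gt0.
have := IH (ltnW ik); rewrite meq; last 2 first.
- exact: measurable_level_set.
- by apply: HK_level_space; lia.
rewrite (HK_map_iter_preimage_measure lambda_gt0 sp (n := 1)) ?addn1//.
move=> /(congr1 (fun y => (len (lv k i.+1) / len (lv k i))%:E * y)%E).
rewrite !muleA -!EFinM !mulrA !divfK ?gt_eqF// divff ?gt_eqF// mul1e.
exact.
Qed.

(** If [A] and its complement in [X] both had positive measure, some column would have one level
    more than half filled by [A] and one more than half filled by the complement, against equality
    of densities. *)
Lemma HK_ergodic : ergodic X mu T.
Proof.
move=> A mA AX invA.
have [A0|A0] := eqVneq (mu A) 0%E; first by left.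
have [B0|B0] := eqVneq (mu (X `\` A)) 0%E; first by right.
exfalso.
have e0 : 0 < 2^-1 :> R by rewrite invr_gt0.
rewrite -measure_gt0 in A0; rewrite -measure_gt0 in B0.
have [K KA] := HK_density mA AX A0 e0.
have [K' KB] := HK_density (measurableD mX mA) (@subDsetl _ _ _) B0 e0.
have [|i [ik iA]] := KA (maxn K K').+1; first lia.
have [|j [jk]] := KB (maxn K K').+1; first lia.
set k := (maxn K K').+1 in ik iA jk *.
have mL n : measurable (L k n : set (measurableTypeR R)).
  exact: measurable_level_set.
have -> : L k j `\` (X `\` A) = L k j `&` A.
  apply/seteqP; split=> x [jx]; last by move=> Ax; split=> // -[].
  move=> nA; split=> //; apply: contrapT => nAx; apply: nA; split=> //.
  exact: (HK_level_space jk).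
rewrite (HK_invariant_density mA AX invA jk).
have k0 : (0 < h k)%N by exact: leq_ltn_trans ik.
have : mu (L k i) = (len (lv k i))%:E.
  by apply: level_set_measure; exact: len_gt0.
have -> : mu (L k i) = (mu (L k i `\` A) + mu (L k i `&` A))%E.
  exact: measureDI.
rewrite (HK_invariant_density mA AX invA ik).
move: iA; have : (mu (L k 0 `&` A) <= (len (lv k 0))%:E)%E.
  by rewrite -level_set_measure ?len_gt0// measureIl.
have : (0 <= mu (L k 0 `&` A))%E by exact: measure_ge0.
have : (0 <= mu (L k i `\` A))%E by exact: measure_ge0.
case: (mu (L k 0 `&` A)) => // s; case: (mu (L k i `\` A)) => // r.
rewrite !lee_fin !lte_fin -EFinM => r0 s0 _ ri [si].
have li := len_gt0 ik; have lj := len_gt0 jk; have l0 := len_gt0 k0.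
(* [u] is the common density of [A] in the levels of column [k]: level [j] gives [u < 1/2], level
   [i] gives [u > 1/2]. *)
move=> s2; pose u := s / len (lv k 0).
have uE l : l / len (lv k 0) * s = l * u by rewrite /u mulrAC mulrA.
move: s2 si; rewrite !uE [ltRHS]mulrC ltr_pM2l// => u2 si.
have : len (lv k i) * 2^-1 < len (lv k i) * u by lra.
by rewrite ltr_pM2l//; lra.
Qed.

End HKErgodic.

(* Two powers of lambda within t * (1 - lambda) / 4 of t coincide, so an
   approximable t > 0 is itself a power of lambda. *)
Lemma approx_exprz_eq (R : realFieldType) (lambda t : R) :
  0 < lambda -> lambda < 1 -> 0 < t ->
  (forall e : R, 0 < e -> exists z : int, `|lambda ^ z - t| < e) ->
  exists z : int, lambda ^ z = t.
Proof.
move=> lambda_gt0 lambda_lt1 t0 tP.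
have e0 : 0 < t * (1 - lambda) / 4.
  by rewrite divr_gt0// mulr_gt0// subr_gt0.
have [a aP] := tP _ e0; have [at_|at_] := eqVneq (lambda ^ a) t.
  by exists a.
have d0 : 0 < `|lambda ^ a - t| by rewrite normr_gt0 subr_eq0.
(* Unless [lambda ^ a] equals [t], a second approximation is taken strictly closer than the first,
   so its exponent [b] differs from [a]. *)
have [|b] := tP (Num.min (t * (1 - lambda) / 4) `|lambda ^ a - t|).
  by rewrite lt_min e0.
rewrite lt_min => /andP[bP ba].
have gap (x y : int) : x < y -> lambda ^ y <= lambda * lambda ^ x.
  move=> xy; have [m ->] : exists m : nat, y = 1 + x + m%:Z.
    by exists `|(y - x - 1)%R|%N; lia.
  rewrite !expfzDr ?gt_eqF// expr1z ger_pMr.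
    by rewrite -exprnP exprn_ile1// ltW.
  by rewrite mulr_gt0// exprz_gt0.
have sep (x y : int) : x < y -> `|lambda ^ x - t| < t * (1 - lambda) / 4 ->
    `|lambda ^ y - t| < t * (1 - lambda) / 4 -> False.
  move=> /gap; set u := lambda ^ x; set v := lambda ^ y => uv.
  rewrite !ltr_distlC => /andP[ut _] /andP[_ tv].
  set w := t * (1 - lambda) in e0 ut tv.
  have uw : lambda * u < lambda * (t + w / 4).
    by rewrite ltr_pM2l// -ltrBlDr.
  have w0 : 0 < w by rewrite mulr_gt0// subr_gt0.
  have lw : lambda * w < w by rewrite gtr_pMl.
  have wE : w = t - lambda * t by rewrite /w; ring.
  lra.
have [ab|ab|ab] := ltgtP a b.
- by have := sep _ _ ab aP bP.
- by have := sep _ _ ab bP aP.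
- by move: ba; rewrite ab ltxx.
Qed.

(** * Computation of the ratio set *)

Section HKRatioSet.
Context {R : realType} {lambda : R} {spacers : nat -> seq (R * R)}.
Hypotheses (lambda_gt0 : 0 < lambda) (sp : HK_spacers lambda spacers).
Local Notation h := (HK_height lambda spacers).
Local Notation lv := (HK_level lambda spacers).
Local Notation L k i :=
  (level_set (HK_level lambda spacers k i) : set (measurableTypeR R)).
Local Notation X := (HK_space lambda spacers).
Local Notation T := (HK_map lambda spacers).
Local Notation mu := (@lebesgue_measure R).
Implicit Types (A : set (measurableTypeR R)) (i j k n : nat).

Let len_gt0 := len_HK_level_gt0 lambda_gt0 sp.
Let mX := measurable_HK_space lambda_gt0 sp.
Let lambda1_gt0 : 0 < 1 + lambda. Proof. by rewrite addr_gt0. Qed.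

(** Take the right part in the first [q] cuts and the left part in the remaining [p - q]. Each cut
    divides the length by [1 + lambda], and each right part contributes a factor [lambda]. *)
Lemma HK_sublevel p q k i : (i < h k)%N -> (q <= p)%N ->
  exists j, [/\ (j < h (k + p))%N, L (k + p) j `<=` L k i &
    len (lv (k + p) j) = len (lv k i) * lambda ^+ q / (1 + lambda) ^+ p].
Proof.
move=> ik; elim: p q => [|p IH] q.
  rewrite leqn0 => /eqP ->; exists i.
  by rewrite addn0 !expr0 divr1 mulr1; split.
have hS := HK_heightS lambda_gt0 sp (k + p).
rewrite leq_eqVlt => /predU1P[->|]; last rewrite ltnS => qp.
  have [j [jk jL jlen]] := IH p (leqnn p).
  exists (h (k + p) + j)%N; rewrite addnS HK_level_right//; split.
  - by rewrite hS; lia.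
  - move=> x jx; apply: jL; apply/(level_set_cut lambda_gt0); last by right.
    exact: len_gt0.
  - by rewrite len_cut_right// jlen !exprS invfM; ring.
have [j [jk jL jlen]] := IH q qp.
exists j; rewrite addnS HK_level_left//; split.
- by rewrite hS; lia.
- move=> x jx; apply: jL; apply/(level_set_cut lambda_gt0); last by left.
  exact: len_gt0.
- by rewrite len_cut_left jlen !exprS invfM; ring.
Qed.

Lemma measurable_omega_HK_map_near A n (t e : R) : measurable A -> A `<=` X ->
  measurable (A `&` iter n T @^-1` A `&`
    [set x | `|omega X mu T n x - t| < e]).
Proof.
move=> mA AX; have [mw _ _] := omega_HK_map_RN lambda_gt0 sp n.
have mTA : measurable (X `&` iter n T @^-1` A).
  exact: (measurable_fun_HK_map_iter lambda_gt0 sp n mX).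
have mS : measurable (X `&` [set x | `|omega X mu T n x - t| < e]).
  have : measurable_fun X (fun x => `|omega X mu T n x - t|).
    apply: measurableT_comp => //; exact: measurable_funB.
  move=> /(_ mX `]-oo, e[%classic (measurable_itv _)).
  by congr (measurable (_ `&` _)); apply/seteqP; split=> x; rewrite /= in_itv.
have := measurableI _ _ (measurableI _ _ mA mTA) mS.
congr measurable; apply/seteqP; split=> x; first by move=> [[? []]] ? ? [].
by move=> [[Ax ?] ?]; have Xx := AX _ Ax; do !split.
Qed.

(** The source sublevel takes [b] right parts in [p] cuts, then a left part; the target takes [c]
    right parts, then one more. Hence the exponent [c.+1 - b], and the last cut places the target
    above the source whatever [b] and [c] are. *)
Lemma HK_return_level p b c A : measurable A -> A `<=` X -> (0 < mu A)%E ->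
  (b <= p)%N -> (c <= p)%N -> exists n k i,
  [/\ (0 < n)%N, (i + n < h k)%N,
    len (lv k (i + n)) / len (lv k i) = lambda ^+ c.+1 / lambda ^+ b &
    (0 < mu (L k i `&` (A `&` iter n T @^-1` A)))%E].
Proof.
move=> mA AX A0 bp cp.
(* [a] and [g] are the lengths of source and target relative to the level containing them. *)
pose a := lambda ^+ b / (1 + lambda) ^+ p.+1.
pose g := lambda ^+ c.+1 / (1 + lambda) ^+ p.+1.
have a0 : 0 < a by rewrite divr_gt0 ?exprn_gt0.
have g0 : 0 < g by rewrite divr_gt0 ?exprn_gt0.
(* With this tolerance, the part of the level outside [A] measures less than half of either
   sublevel. *)
have e0 : 0 < Num.min a g / 2 by rewrite divr_gt0// lt_min a0.
have [K KA] := HK_density lambda_gt0 sp mA AX A0 e0.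
have [i [ik iA]] := KA K.+1 (leqnn _); set k := K.+1 in ik iA.
have li : 0 < len (lv k i) by exact: len_gt0.
have [j1 [j1k j1L j1len]] := HK_sublevel ik bp.
have [j2 [j2k j2L j2len]] := HK_sublevel ik cp.
have hS := HK_heightS lambda_gt0 sp (k + p).
(* The right subcolumn starts at height [h (k + p)], which exceeds [j1], so the return time is
   positive. *)
exists (h (k + p) + j2 - j1)%N, (k + p).+1, j1.
have nE : (j1 + (h (k + p) + j2 - j1) = h (k + p) + j2)%N by lia.
rewrite nE; set n := (h (k + p) + j2 - j1)%N.
have n0 : (0 < n)%N by rewrite /n; lia.
have nh : (j1 + n < h (k + p).+1)%N by rewrite /n; lia.
have l1E : len (lv (k + p).+1 j1) = len (lv k i) * a.
  by rewrite HK_level_left// len_cut_left j1len /a !exprS invfM; ring.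
have l2E : len (lv (k + p).+1 (h (k + p) + j2)) = len (lv k i) * g.
  by rewrite HK_level_right// len_cut_right// j2len /g !exprS invfM; ring.
split=> //; first lia.
  rewrite l1E l2E /a /g.
  have := exprn_gt0 p.+1 lambda1_gt0; have := exprn_gt0 b lambda_gt0.
  by move=> ? ?; field; rewrite !gt_eqF.
set J1 := L (k + p).+1 j1.
have mJ1 : measurable J1.
  exact: measurable_level_set.
have J1L : J1 `<=` L k i.
  move=> x; rewrite /J1 HK_level_left// => jx; apply: j1L.
  by apply/(level_set_cut lambda_gt0); [exact: len_gt0|left].
have J2L : L (k + p).+1 (h (k + p) + j2) `<=` L k i.
  move=> x; rewrite HK_level_right// => jx; apply: j2L.
  by apply/(level_set_cut lambda_gt0); [exact: len_gt0|right].
have mcA : measurable (~` A) by exact: measurableC.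
have mLA : measurable (L k i `\` A).
  by apply: measurableD => //; exact: measurable_level_set.
set J2 := L (k + p).+1 (h (k + p) + j2) in J2L.
have mJ2 : measurable J2.
  exact: measurable_level_set.
have mS1 : measurable (J1 `\` A) by exact: measurableD.
have S1lt : (mu (J1 `\` A) < (len (lv k i) * a / 2)%:E)%E.
  apply: le_lt_trans (lt_le_trans iA _).
    by apply: le_measure; rewrite ?inE// => x [/J1L].
  rewrite lee_fin mulrC mulrA ler_pM2r ?invr_gt0// ler_pM2l//.
  by rewrite ge_min lexx.
have mS2 : measurable (J1 `&` iter n T @^-1` (~` A)).
  exact: measurable_HK_map_iter_preimage.
(* [iter n T] carries [J1] onto [J2] with ratio [g / a], so the bound of half of [J2] pulls back to
   half of [J1]. *)
have S2lt : (mu (J1 `&` iter n T @^-1` (~` A)) < (len (lv k i) * a / 2)%:E)%E.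
  rewrite HK_map_iter_preimage_measure// nE l1E l2E.
  have J2lt : (mu (J2 `&` ~` A) < (len (lv k i) * g / 2)%:E)%E.
    apply: le_lt_trans (lt_le_trans iA _).
      apply: le_measure; rewrite ?inE//; first exact: measurableI.
      by move=> x [/J2L].
    rewrite lee_fin mulrC mulrA ler_pM2r ?invr_gt0// ler_pM2l//.
    by rewrite ge_min lexx orbT.
  rewrite -/J2 (_ : len (lv k i) * a / 2 =
    len (lv k i) * a / (len (lv k i) * g) * (len (lv k i) * g / 2)); last first.
    by field; rewrite !gt_eqF.
  rewrite [ltRHS]EFinM lte_pmul2l ?J2lt ?lte_fin//.
  by apply: divr_gt0; exact: mulr_gt0.
have mJA : measurable (J1 `&` (A `&` iter n T @^-1` A)).
  rewrite setICA; apply: measurableI => //.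
  exact: measurable_HK_map_iter_preimage.
(* Otherwise two sets, each smaller than half of [J1], would cover it up to a null set. *)
rewrite lt_neqAle measure_ge0 andbT; apply/negP => /eqP /esym JA0.
have : (mu J1 <= mu (J1 `\` A `|` J1 `&` iter n T @^-1` (~` A) `|`
    J1 `&` (A `&` iter n T @^-1` A)))%E.
  apply: le_measure; rewrite ?inE//.
    by apply: measurableU => //; exact: measurableU.
  move=> x jx; have [Ax|nAx] := pselect (A x); last by left; left.
  by have [TAx|nTAx] := pselect (A (iter n T x)); [right|left; right].
apply/negP; rewrite -ltNge.
apply: le_lt_trans (measureU2 _ _ _) _ => //; first exact: measurableU.
rewrite [X in (_ + X)%E]JA0 adde0.
apply: le_lt_trans (measureU2 _ mS1 mS2) _.
apply: lt_le_trans (lteD S1lt S2lt) _.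
rewrite -EFinD -splitr -l1E -level_set_measure//.
by apply: len_gt0; lia.
Qed.

Lemma HK_ratio_exp A (z : int) (e : R) :
  measurable A -> A `<=` X -> (0 < mu A)%E -> 0 < e ->
  exists n, (0 < n)%N /\ (0 < mu (A `&` iter n T @^-1` A `&`
    [set x | (`|omega X mu T n x - lambda ^ z| < e)%R]))%E.
Proof.
move=> mA AX A0 e0.
(* The final right part forces an exponent of at least one in the numerator; [b] compensates for
   it. *)
have [b [c zE]] : exists b c, lambda ^ z = lambda ^+ c.+1 / lambda ^+ b.
  case: z => m.
    by exists 1%N, m; rewrite expr1 exprSr mulfK// gt_eqF.
  exists m.+2, 0%N; rewrite expr1 [lambda ^+ m.+2]exprS invfM mulrA.
  by rewrite divff ?mul1r// gt_eqF.
have [n [k [i [n0 ik lE muJ]]]] :=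
  HK_return_level mA AX A0 (leq_maxl b c) (leq_maxr b c).
exists n; split=> //; set S := _ `&` [set x | _].
have mS : measurable S by exact: measurable_omega_HK_map_near.
have mTA : measurable (X `&` iter n T @^-1` A).
  exact: (measurable_fun_HK_map_iter lambda_gt0 sp n mX).
have mJ : measurable (L k i `&` (A `&` iter n T @^-1` A)).
  have <- : A `&` (X `&` iter n T @^-1` A) = A `&` iter n T @^-1` A.
    by rewrite setIA (setIidl AX).
  apply: measurableI; first exact: measurable_level_set.
  exact: measurableI.
(* If [S] were null, some point of the returning set, which has positive measure, would both avoid
   [S] and satisfy the formula for [omega], which puts it in [S]. *)
rewrite lt_neqAle measure_ge0 andbT; apply/negP => /eqP/esym S0.
have aeS : {ae mu, forall x, ~ S x} by exists S; split=> // x /= /contrapT.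
have aeI : {ae mu, forall x, (L k i x -> omega X mu T n x =
    len (lv k (i + n)) / len (lv k i)) /\ ~ S x}.
  by have := omega_HK_map_ae lambda_gt0 sp ik; apply: filterS2 aeS => x.
have [x [[ix [Ax TAx]] [wx nSx]]] := ae_exists mJ muJ aeI.
by apply: nSx; split=> //=; rewrite wx// lE zE subrr normr0.
Qed.

(** A piece of [[0, 1[] in column [k] has undergone exactly [k] cuts, [a] of them keeping the right
    part. The denominator is thus common to all these pieces and cancels in ratios. *)
Lemma HK_unit_level k x : L 0 0 x -> exists i a, [/\ (i < h k)%N, L k i x &
  len (lv k i) = lambda ^+ a / (1 + lambda) ^+ k].
Proof.
move=> x0; elim: k => [|k [i [a [ik ix iE]]]].
  by exists 0%N, 0%N; split=> //; rewrite /len/= subr0 !expr0 divr1.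
have hS := HK_heightS lambda_gt0 sp k.
have /(level_set_cut lambda_gt0 _ (len_gt0 ik))[] := ix => [jx|jx].
  exists i, a; rewrite HK_level_left//; split=> //; first lia.
  by rewrite len_cut_left iE exprS invfM; ring.
exists (h k + i)%N, a.+1; rewrite HK_level_right//; split=> //; first lia.
by rewrite len_cut_right// iE !exprS invfM; ring.
Qed.

(** The ratio set condition is tested on [[0, 1[]: a returning point and its image lie in two pieces
    of [[0, 1[] in one column, whose lengths differ by a power of [lambda]. *)
Lemma HK_ratio_approx t (e : R) : t \in ratio_set X mu T -> 0 < e ->
  exists z : int, `|lambda ^ z - t| < e.
Proof.
move=> /[!inE] -[t0 tP] e0.
have L0X : L 0 0 `<=` X by exact: HK_level_space.
have L0_gt0 : (0 < mu (L 0 0))%E.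
  by rewrite level_set_measure ?lte_fin /len/= subr0.
have [n [n0 Sgt0]] := tP e e0 _ (measurable_level_set _) L0X L0_gt0.
have mS := measurable_omega_HK_map_near n t e (measurable_level_set _) L0X.
(* The column in which [n] steps from [x] are visible depends on [x], so the formula for [omega] is
   needed for all [k] and [i] at once, a countable family. *)
have aew1 k i : {ae mu, forall x, (i + n < h k)%N -> L k i x ->
    omega X mu T n x = len (lv k (i + n)) / len (lv k i)}.
  have [ik|ik] := boolP (i + n < h k)%N; last exact: aeW.
  have [N [mN N0 NP]] := omega_HK_map_ae lambda_gt0 sp ik.
  by exists N; split=> // x; move=> nx; apply: NP => wx; apply: nx => _ /wx.
have aew : {ae mu, forall x, forall k i, (i + n < h k)%N -> L k i x ->
    omega X mu T n x = len (lv k (i + n)) / len (lv k i)}.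
  by apply: ae_foralln => k; apply: ae_foralln => i; exact: aew1.
have [x [[[x0 Tx0] /= wt] wE]] := ae_exists mS Sgt0 aew.
have [K /(_ n (maxn K n).+1)[||i [ik ix]]] :=
  HK_spaceP lambda_gt0 sp (L0X _ x0).
- by lia.
- by lia.
set k := (maxn K n).+1 in ik ix.
have [i' [a [ik' ix' iE]]] := HK_unit_level k x0.
have [j [b [jk jx jE]]] := HK_unit_level k Tx0.
have ii' : i = i' by apply: (HK_level_uniq sp _ ik' ix ix'); lia.
have ij : (i + n)%N = j.
  by apply: (HK_level_uniq sp ik jk _ jx); exact: HK_map_iter_level.
exists (b%:Z - a%:Z); move: wt; rewrite (wE _ _ ik ix) ij ii' iE jE.
have -> // : lambda ^+ b / (1 + lambda) ^+ k /
  (lambda ^+ a / (1 + lambda) ^+ k) = lambda ^ (b%:Z - a%:Z).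
rewrite expfzDr ?gt_eqF// -invr_expz -!exprnP.
have := exprn_gt0 k lambda1_gt0; have := exprn_gt0 a lambda_gt0.
by move=> ? ?; field; rewrite !gt_eqF.
Qed.

Lemma HK_ratio_set : lambda < 1 ->
  ratio_set X mu T = [set lambda ^ z | z in [set: int]] `|` [set 0].
Proof.
move=> lambda_lt1; apply/seteqP; split=> [t tP|t].
  have [t0 _] := tP; move: t0; rewrite le_eqVlt => /predU1P[<-|t0].
    by right.
  left; have [|z zt] := approx_exprz_eq lambda_gt0 lambda_lt1 t0.
    by move=> e e0; apply: HK_ratio_approx e0; rewrite inE.
  by exists z.
move=> [[z _ <-]|->].
  split=> [|e e0 A mA AX A0]; first by rewrite exprz_ge0// ltW.
  exact: HK_ratio_exp.
(* For [0], a power of [lambda] below [e / 2] is approximated within [e / 2]. *)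
split=> // e e0 A mA AX A0.
have e20 : 0 < e / 2 by rewrite divr_gt0.
have [s se] : exists s : nat, lambda ^+ s < e / 2.
  have l1 : `|lambda| < 1 by rewrite gtr0_norm.
  have /cvgrPdist_lt /(_ _ e20) [s _ sP] := cvg_expr l1.
  exists s; have := sP s (leqnn s); rewrite sub0r normrN.
  exact/le_lt_trans/ler_norm.
have [n [n0 nP]] := HK_ratio_exp s mA AX A0 e20.
exists n; split=> //; apply: lt_le_trans nP _.
apply: le_measure; rewrite ?inE; [exact: measurable_omega_HK_map_near..|].
move=> x [Tx /= xs]; split=> //=.
rewrite subr0 -[omega X mu T n x](subrK (lambda ^ s)).
rewrite (le_lt_trans (ler_normD _ _))// [ltRHS]splitr ltrD//.
by rewrite gtr0_norm// exprz_gt0.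
Qed.

End HKRatioSet.

Theorem theorem4p1 (R : realType) (lambda : R) (spacers : nat -> seq (R * R))
    (hlambda : 0 < lambda < 1) (hspacers : HK_spacers lambda spacers) :
  ergodic (HK_space lambda spacers) (@lebesgue_measure R)
    (HK_map lambda spacers) /\
  type_III (HK_space lambda spacers) (@lebesgue_measure R)
    (HK_map lambda spacers) lambda.
Proof.
have /andP[lambda_gt0 lambda_lt1] := hlambda.
split; first exact: HK_ergodic.
split; [exact: HK_nonsingular|exact: HK_invertible_ae|exact: HK_ergodic|].
exact: HK_ratio_set.
Qed.
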